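(* For Lebesgue-almost all $x\in(0,1]$, $$\lim_{n\to\infty}\frac{L_n(x)}{\log_2 n}=1,$$ where $L_n(x)=\max\{d_i(x):1\le i\le n\}$.
   Context: $\mathbb{N}=\{1,2,3,\dots\}$. Every $x\in(0,1]$ has a unique expansion $x=\sum_{i=1}^{\infty}2^{-(d_1(x)+d_2(x)+\cdots+d_i(x))}$ with all $d_i(x)\in\mathbb{N}$ (the power-2-decaying Gauss-like expansion); this defines the digit functions $d_i:(0,1]\to\mathbb{N}$. Equivalently, with $T:(0,1]\to(0,1]$ given by $Tx=2^nx-1$ for $x\in(2^{-n},2^{-(n-1)}]$, $n\in\mathbb{N}$, the digit $d_i(x)$ is the unique $n\in\mathbb{N}$ with $T^{i-1}x\in(2^{-n},2^{-(n-1)}]$. *)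

(* Defs.v *)
From HB Require Import structures.
From mathcomp Require Import all_boot all_order all_algebra.
From mathcomp Require Import all_classical all_reals all_analysis.
From mathcomp Require Import lra.
Import Order.TTheory GRing.Theory Num.Theory.
Import numFieldNormedType.Exports.

Set Implicit Arguments.
Unset Strict Implicit.
Unset Printing Implicit Defensive.

Local Open Scope classical_set_scope.
Local Open Scope ring_scope.

(* The index n >= 1 of the dyadic cell ]2^-n, 2^-(n-1)] containing x.
   The cells partition ]0, 1], so for such x the index exists and is unique;
   the default value 0 is only taken outside ]0, 1]. *)
Definition first_digit (R : realType) (x : R) : nat :=
  xget 0%N [set n : nat | (0 < n)%N /\ x \in `]2 ^- n, 2 ^- n.-1]].

Definition gauss_map (R : realType) (x : R) : R :=
  2 ^+ first_digit x * x - 1.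

(* Digits are numbered from 1; the value at index 0 is meaningless. *)
Definition digit (R : realType) (i : nat) (x : R) : nat :=
  first_digit (iter i.-1 (@gauss_map R) x).

Definition max_digit (R : realType) (n : nat) (x : R) : nat :=
  \max_(1 <= i < n.+1) digit i x.

Definition log2 (R : realType) (x : R) : R := ln x / ln 2.

(* x = sum_(i >= 1) 2^-(d_1 + ... + d_i) with d_i >= 1 for i >= 1.
   By digit_expansion and expansion_digit below, every x in ]0, 1] has exactly
   one such expansion, and its digits are those given by digit. *)
Definition is_expansion (R : realType) (d : nat -> nat) (x : R) : Prop :=
  (forall i, (0 < i)%N -> (0 < d i)%N) /\
  (fun n => \sum_(1 <= i < n.+1) (2 : R) ^- (\sum_(1 <= j < i.+1) d j)%N)
    @ \oo --> x.

Lemma near_exp2V_lt (R : realType) (e : R) : 0 < e ->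
  \forall n \near \oo, (2 : R) ^- n < e.
Proof.
move=> e0; have : @geometric R 1 2^-1 @ \oo --> (0 : R).
  by apply: cvg_geometric; rewrite ger0_norm ?invr_ge0// invf_lt1// ltr1n.
move=> /cvgrPdist_lt/(_ _ e0); apply: filterS => n.
rewrite sub0r normrN /geometric /= mul1r exprVn.
by rewrite ger0_norm// invr_ge0 exprn_ge0.
Qed.

Lemma first_digitP (R : realType) (x : R) : x \in `]0, 1] ->
  (0 < first_digit x)%N /\
  x \in `]2 ^- first_digit x, 2 ^- (first_digit x).-1].
Proof.
rewrite in_itv /= => /andP[x0 x1].
have ex : exists n, (2 : R) ^- n < x.
  by have [N _ /(_ N (leqnn N))] := near_exp2V_lt x0; exists N.
pose m := ex_minn ex.
apply: (@xgetPex _ 0%N [set n : nat | (0 < n)%N /\ x \in `]2 ^- n, 2 ^- n.-1]]).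
exists m; rewrite /m; case: ex_minnP => k kx mink /=.
have k0 : (0 < k)%N.
  by case: k kx {mink} => //; rewrite expr0 invr1 ltNge x1.
split=> //; rewrite in_itv /= kx /= leNgt; apply/negP => /mink.
by rewrite leqNgt ltn_predL k0.
Qed.

Lemma gauss_map_itv (R : realType) (x : R) : x \in `]0, 1] ->
  gauss_map x \in `]0, 1].
Proof.
move=> /first_digitP[]; rewrite /gauss_map; case: (first_digit x) => // n _ /=.
rewrite !in_itv /= subr_gt0 lerBlDr => /andP[h1 h2].
have p k : 0 < (2 : R) ^+ k by rewrite exprn_gt0.
rewrite -(ltr_pdivrMl _ _ (p _)) mulr1 h1 /=.
rewrite exprS -mulrA -[leRHS]/(2 : R) ger_pMr//.
by rewrite -(ler_pdivlMl _ _ (p _)) mulr1.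
Qed.

Lemma iter_gauss_map_itv (R : realType) (x : R) (n : nat) : x \in `]0, 1] ->
  iter n (@gauss_map R) x \in `]0, 1].
Proof. by move=> x01; elim: n => //= n; exact: gauss_map_itv. Qed.

Lemma digit_expansion (R : realType) (x : R) : x \in `]0, 1] ->
  is_expansion (fun i => digit i x) x.
Proof.
move=> x01; have dP i := first_digitP (iter_gauss_map_itv i x01).
split=> [i _|]; first by case: (dP i.-1).
pose s i := (\sum_(1 <= j < i.+1) digit j x)%N.
have sE n : s n.+1 = (s n + first_digit (iter n (@gauss_map R) x))%N.
  by rewrite /s big_nat_recr.
have s_ge n : (n <= s n)%N.
  elim: n => // n IH; by rewrite sE -[leqLHS]addn1 leq_add//; case: (dP n).
have E n : x - \sum_(1 <= i < n.+1) (2 : R) ^- s i =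
    2 ^- s n * iter n (@gauss_map R) x.
  elim: n => [|n IH]; first by rewrite /s !big_geq// expr0 invr1 mul1r subr0.
  rewrite big_nat_recr//= opprD addrA IH sE exprD invfM.
  rewrite /gauss_map mulrBr mulr1 -mulrA mulKf//.
apply/cvgrPdist_lt => e e0.
apply: filterS (near_exp2V_lt e0) => n; apply: le_lt_trans.
rewrite E; have := iter_gauss_map_itv n x01; rewrite in_itv /= => /andP[t0 t1].
rewrite ger0_norm ?mulr_ge0 ?invr_ge0 ?exprn_ge0 ?(ltW t0)//.
apply: (@le_trans _ _ (2 ^- s n)).
  by rewrite ger_pMr// invr_gt0 exprn_gt0.
by rewrite lef_pV2 ?posrE ?exprn_gt0// ler_eXn2l ?ltr1n.
Qed.

Lemma first_digit_unique (R : realType) (x : R) (n : nat) :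
  (0 < n)%N -> x \in `]2 ^- n, 2 ^- n.-1] -> first_digit x = n.
Proof.
have lt_cell m k : (0 < m)%N -> x \in `]2 ^- k, 2 ^- k.-1] ->
    x \in `]2 ^- m, 2 ^- m.-1] -> (m <= k)%N.
  move=> m0; rewrite !in_itv /= => /andP[kx _] /andP[_ xm].
  have := lt_le_trans kx xm.
  rewrite ltf_pV2 ?posrE ?exprn_gt0// ltr_eXn2l ?ltr1n//.
  by case: m m0 {xm}.
move=> n0 nx; apply: xget_unique => //= m [m0 mx].
by apply/eqP; rewrite eqn_leq !(lt_cell _ _ _ nx mx, lt_cell _ _ _ mx nx).
Qed.

Lemma expansion_cons (R : realType) (d : nat -> nat) (x : R) :
  is_expansion d x -> is_expansion (fun i => d i.+1) (2 ^+ d 1%N * x - 1).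
Proof.
move=> [d0 dx]; split=> [i _|]; first exact: d0.
rewrite -(cvg_shiftS) in dx.
have dy := cvgB (@cvgMl_tmp _ _ _ _ _ (2 ^+ d 1%N) _ dx) (@cvg_cst _ (1 : R) nat \oo _).
apply: (cvg_trans _ (dy _ _ _)); apply: near_eq_cvg; apply: nearW => n /=.
rewrite -[LHS]/(2 ^+ d 1%N * _ - 1).
rewrite big_nat_recl//= big_nat1 mulrDr mulfV ?expf_neq0// addrC addKr.
rewrite mulr_sumr; apply: eq_bigr => i _.
by rewrite big_nat_recl//= exprD invfM mulVKf ?expf_neq0.
Qed.

Lemma expansion_ge (R : realType) (d : nat -> nat) (x : R) (n : nat) :
  is_expansion d x ->
  \sum_(1 <= i < n.+1) (2 : R) ^- (\sum_(1 <= j < i.+1) d j)%N <= x.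
Proof.
move=> [_ dx]; have <- := cvg_lim (@Rhausdorff R) dx.
apply: nondecreasing_cvgn_le; last by apply/cvg_ex; exists x.
apply/nondecreasing_seqP => m; rewrite [leRHS]big_nat_recr//= lerDl.
by rewrite invr_ge0 exprn_ge0.
Qed.

Lemma expansion_itv (R : realType) (d : nat -> nat) (x : R) :
  is_expansion d x -> x \in `]0, 1].
Proof.
move=> dx; rewrite in_itv /=; apply/andP; split.
  apply: lt_le_trans (expansion_ge 1 dx).
  by rewrite big_nat1 invr_gt0 exprn_gt0.
have [d0 cx] := dx; have <- := cvg_lim (@Rhausdorff R) cx.
apply: limr_le; first by apply/cvg_ex; exists x.
apply: nearW => n; apply: (@le_trans _ _ (1 - 2 ^- n)); last first.
  by rewrite gerBl invr_ge0 exprn_ge0.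
have s_ge k : (k <= \sum_(1 <= j < k.+1) d j)%N.
  by elim: k => // k IH; rewrite big_nat_recr//= -[leqLHS]addn1 leq_add// d0.
elim: n => [|n IH]; first by rewrite big_geq// expr0 invr1 subrr.
rewrite big_nat_recr//=; apply: (le_trans (lerD IH (_ : _ <= 2 ^- n.+1))).
  by rewrite lef_pV2 ?posrE ?exprn_gt0// ler_eXn2l ?ltr1n.
by rewrite exprS invfM; lra.
Qed.

Lemma expansion_first_digit (R : realType) (d : nat -> nat) (x : R) :
  is_expansion d x -> first_digit x = d 1%N.
Proof.
move=> dx; have d1 := dx.1 _ (ltn0Sn 0).
apply: first_digit_unique => //.
have := expansion_itv (expansion_cons dx); rewrite !in_itv /=.
have p k : 0 < (2 : R) ^+ k by rewrite exprn_gt0.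
rewrite subr_gt0 lerBlDr => /andP[h1 h2].
rewrite -[ltLHS]mulr1 ltr_pdivrMl// h1 /= -[leRHS]mulr1 ler_pdivlMl//.
rewrite -(ler_pM2l (ltr0n R 2)) mulrA -exprS prednK// mulr1.
by apply: le_trans h2 _; lra.
Qed.

Lemma expansion_digit (R : realType) (d : nat -> nat) (x : R) (i : nat) :
  is_expansion d x -> (0 < i)%N -> digit i x = d i.
Proof.
case: i => // i + _; rewrite /digit /=.
elim: i d x => [|i IH] d x dx; first exact: expansion_first_digit.
rewrite iterSr (IH (fun j => d j.+1))// /gauss_map (expansion_first_digit dx).
exact: expansion_cons.
Qed.

(* Main.v *)
(* With k fixed, the points whose first n digits are all at most k, and those
   with a digit above k among the first n, are built up from the inverse
   branches y |-> 2^-j (1 + y), 1 <= j <= k, of the Gauss-like map, so their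
   measures are at most (1 - 2^-k)^n and n 2^-k.  Take n = 2^m and k = m -+ s
   with s of order 2 log_2 m: both bounds are at most 2^-s = O(m^-2), hence
   summable, and by Borel-Cantelli |L_(2^m)(x) - m| <= s for almost all x and
   all large m.  As s = o(m) and L_n is monotone in n, the limit over all n
   follows by comparing n with the two powers of 2 around it. *)

Require Import Defs.
From HB Require Import structures.
From mathcomp Require Import all_boot all_order all_algebra.
From mathcomp Require Import all_classical all_reals all_analysis.
From mathcomp Require Import ring lra zify.
Import Order.TTheory GRing.Theory Num.Theory.
Import numFieldNormedType.Exports.

Local Open Scope classical_set_scope.
Local Open Scope ring_scope.

(* Bounding all affine copies of S at once makes the bound stable under the
   inverse branches without any scaling property of the Lebesgue measure, and
   only subadditivity is needed: the pieces need not be shown disjoint. *)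
Definition affine_bounded (R : realType) (S : set R) (p : R) : Prop :=
  forall a c : R, 0 < c ->
    measurable ([set a + c * x | x in S] : set R) /\
    (lebesgue_measure [set (a + c * x)%R | x in S] <= (c * p)%:E)%E.

(** * Measure bounds uniform over affine copies *)

Section affine_bounded.
Context {R : realType}.
Implicit Types (S : set R) (p b : R).

Lemma affine_boundedW S p q : p <= q ->
  affine_bounded R S p -> affine_bounded R S q.
Proof.
move=> pq Sp a c c0; have [mS le_S] := Sp a c c0; split=> //.
by apply: le_trans le_S _; rewrite lee_fin ler_pM2l.
Qed.

Lemma affine_bounded_le S p : affine_bounded R S p ->
  measurable S /\ (lebesgue_measure S <= p%:E)%E.
Proof.
move=> /(_ 0 1 ltr01); rewrite mul1r.
suff -> : [set 0 + 1 * x | x in S] = S by [].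
under eq_imagel do rewrite add0r mul1r.
exact: image_id.
Qed.

Lemma affine_bounded0 : affine_bounded R set0 0.
Proof. by move=> a c _; rewrite image_set0 measure0 mulr0. Qed.

Lemma affine_bounded_itv b : 0 <= b -> affine_bounded R `]0, b] b.
Proof.
move=> b0 a c c0.
have -> : [set a + c * x | x in `]0, b]] = `]a, a + c * b]%classic.
  apply/seteqP; split=> [_ [x /= + <-]|y /=]; rewrite !in_itv/=.
    by move=> /andP[x0 xb]; rewrite ltrDl mulr_gt0// lerD2l ler_pM2l.
  move=> /andP[ay yb]; exists ((y - a) / c); last by field; rewrite gt_eqF.
  by rewrite /= in_itv/= divr_gt0 ?subr_gt0//= ler_pdivrMr// lerBlDl mulrC.
split; first exact: measurable_itv.
rewrite lebesgue_measure_itv/= lte_fin; case: ifPn => _.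
  by rewrite -EFinD lee_fin addrAC subrr add0r.
by rewrite lee_fin mulr_ge0// ltW.
Qed.

Lemma affine_boundedU S1 S2 p1 p2 :
  affine_bounded R S1 p1 -> affine_bounded R S2 p2 ->
  affine_bounded R (S1 `|` S2) (p1 + p2).
Proof.
move=> S1p S2p a c c0; have [m1 le1] := S1p a c c0; have [m2 le2] := S2p a c c0.
rewrite image_setU; split; first exact: measurableU.
apply: (le_trans (measureU2 (@lebesgue_measure R) m1 m2)).
by rewrite mulrDr EFinD leeD.
Qed.

(** Affine maps compose, so an affine copy of the image is one of [S]. *)
Lemma affine_bounded_image S p (a c : R) : 0 < c ->
  affine_bounded R S p -> affine_bounded R [set a + c * x | x in S] (c * p).
Proof.
move=> c0 Sp b d d0; have [mS leS] := Sp (b + d * a) (d * c) (mulr_gt0 d0 c0).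
suff -> : [set b + d * y | y in [set a + c * x | x in S]]
    = [set b + d * a + d * c * x | x in S] by rewrite mulrA.
by rewrite image_comp; apply: eq_imagel => x _ /=; rewrite mulrDr mulrA addrA.
Qed.

(** * Inverse branches of the Gauss-like map *)

Definition branches (k : nat) (S : set R) : set R :=
  [set x | [/\ x \in `]0, 1], (first_digit x <= k)%N & S (gauss_map x)]].

Lemma branches0 S : branches 0 S = set0.
Proof.
apply/seteqP; split=> // x [/first_digitP[d0 _]].
by rewrite leqn0 => /eqP d; rewrite d in d0.
Qed.

(** On the cell of digit [k.+1], [gauss_map] is inverted by y |-> 2^-(k+1) (1 + y), which maps ]0,
    1] back into that cell. *)
Lemma branchesS k S : S `<=` `]0, 1] ->
  branches k.+1 S =
  branches k S `|` [set 2 ^- k.+1 + 2 ^- k.+1 * y | y in S].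
Proof.
move=> S01.
have p n : 0 < (2 : R) ^+ n by rewrite exprn_gt0.
apply/seteqP; split=> [x [x01 dk Sx]|x [[x01 dk Sx]|[y Sy <-]]].
- have [xk|xk] := leqP (first_digit x) k; [by left|right].
  have {dk xk}dE : first_digit x = k.+1 by apply/eqP; rewrite eqn_leq dk.
  exists (gauss_map x) => //.
  by rewrite /gauss_map dE -[X in X + _]mulr1 -mulrDr addrC subrK mulKf ?gt_eqF.
- by split=> //; exact: leqW.
- have := S01 _ Sy; rewrite /= in_itv/= => /andP[y0 y1].
  have xd : 2 ^- k.+1 + 2 ^- k.+1 * y \in `]2 ^- k.+1, 2 ^- k]%R.
    rewrite in_itv/= ltrDl mulr_gt0 ?invr_gt0//=.
    rewrite -[X in X + _]mulr1 -mulrDr exprS invfM -mulrA ler_pdivrMl//.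
    by rewrite mulrC ler_pM2r ?invr_gt0//; lra.
  have dE : first_digit (2 ^- k.+1 + 2 ^- k.+1 * y) = k.+1.
    exact: first_digit_unique.
  split; last 1 first.
  + rewrite /gauss_map dE mulrDr mulVKf ?gt_eqF// mulfV ?gt_eqF//.
    by rewrite addrAC subrr add0r.
  + move: xd; rewrite !in_itv/= => /andP[h1 h2].
    rewrite (lt_trans _ h1) ?invr_gt0//= (le_trans h2)//.
    by rewrite invf_le1// exprn_ege1// ler1n.
  + by rewrite dE.
Qed.

(** The branches contract by 2^-1, ..., 2^-k, and these ratios add up to 1 - 2^-k. *)
Lemma affine_bounded_branches k S p : S `<=` `]0, 1] ->
  affine_bounded R S p -> affine_bounded R (branches k S) ((1 - 2 ^- k) * p).
Proof.
move=> S01 Sp; elim: k => [|k IH].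
  by rewrite branches0 expr0 invr1 subrr mul0r; exact: affine_bounded0.
rewrite branchesS//.
have -> : (1 - 2 ^- k.+1) * p = (1 - 2 ^- k) * p + 2 ^- k.+1 * p :> R.
  by rewrite exprS invfM; lra.
by apply: affine_boundedU => //; exact: affine_bounded_image.
Qed.

Lemma max_digitS n (x : R) :
  max_digit n.+1 x = maxn (first_digit x) (max_digit n (gauss_map x)).
Proof.
rewrite /max_digit big_ltn//; congr maxn.
rewrite big_add1/= big_nat [RHS]big_nat.
by apply: eq_bigr => -[//|i] _; rewrite /digit/= -iterSr.
Qed.

(** * Points with small or large maximal digit *)

Definition low k n : set R := [set x | x \in `]0, 1] /\ (max_digit n x <= k)%N].
Definition high k n : set R := [set x | x \in `]0, 1] /\ (k < max_digit n x)%N].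

(** By [max_digitS], one more digit means one more passage through [branches k], hence one more
    factor 1 - 2^-k. *)
Lemma affine_bounded_low k n : affine_bounded R (low k n) ((1 - 2 ^- k) ^+ n).
Proof.
elim: n => [|n IH].
  have -> : low k 0 = `]0, 1]%classic.
    apply/seteqP; split=> [x []//|x x01].
    by rewrite /low/= /max_digit big_geq.
  exact: affine_bounded_itv.
have -> : low k n.+1 = branches k (low k n).
  apply/seteqP; split=> x; rewrite /low/= max_digitS geq_max.
    by move=> [x01 /andP[]]; split=> //; split=> //; exact: gauss_map_itv.
  by move=> [x01 -> [_ ->]].
by rewrite exprS; apply: affine_bounded_branches => // x [].
Qed.

Lemma first_digit_gt k (x : R) : x \in `]0, 1] ->
  (k < first_digit x)%N = (x <= 2 ^- k).
Proof.
move=> /first_digitP[d0]; rewrite in_itv/= => /andP[dx xd].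
have [kd|dk] := ltnP.
  apply/esym/(le_trans xd).
  by rewrite lef_pV2 ?posrE ?exprn_gt0// ler_eXn2l ?ltr1n//; lia.
apply/esym/negbTE; rewrite -ltNge; apply: le_lt_trans dx.
by rewrite lef_pV2 ?posrE ?exprn_gt0// ler_eXn2l ?ltr1n.
Qed.

(** Either the first digit exceeds [k], which confines the point to ]0, 2^-k], or a later one does,
    and [gauss_map] reduces this to [n] digits. *)
Lemma affine_bounded_high k n : affine_bounded R (high k n) (n%:R * 2 ^- k).
Proof.
have k0 : 0 < (2 : R) ^- k by rewrite invr_gt0 exprn_gt0.
have k1 : (2 : R) ^- k <= 1.
  by rewrite invf_le1 ?exprn_gt0// exprn_ege1// ler1n.
elim: n => [|n IH].
  have -> : high k 0 = set0.
    by apply/seteqP; split=> x // -[_]; rewrite /max_digit big_geq.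
  by rewrite mul0r; exact: affine_bounded0.
have -> : high k n.+1 = `]0, 2 ^- k]%classic `|` branches k (high k n).
  apply/seteqP; split=> x; rewrite /high/= max_digitS leq_max.
    move=> [x01]; rewrite first_digit_gt//.
    have [xk _|xk] := leP x (2 ^- k); [left|right].
      by move: x01; rewrite !in_itv/= xk => /andP[->].
    split=> //; last by split=> //; exact: gauss_map_itv.
    by rewrite leqNgt first_digit_gt// -ltNge.
  case=> [xk|[x01 dk [gx01 kx]]]; last by rewrite kx orbT.
  have x01 : x \in `]0, 1].
    by move: xk; rewrite !in_itv/= => /andP[-> /le_trans->].
  by rewrite first_digit_gt//; move: xk; rewrite in_itv/= => /andP[_ ->].
apply: affine_boundedW; last first.
  apply: affine_boundedU; first by apply: affine_bounded_itv; exact: ltW.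
  by apply: affine_bounded_branches IH => x [].
by rewrite -[n.+1%:R]natr1 [leRHS]mulrDl mul1r addrC lerD2r -[leRHS]mul1r ler_wpM2r//.
Qed.

End affine_bounded.

(** * Elementary estimates *)

(** The product decreases with [n], since (1 - x) (1 + (n + 1) x) <= 1 + n x. *)
Lemma expr1B_bernoulli (R : realFieldType) (x : R) n :
  0 <= x <= 1 -> (1 - x) ^+ n * (1 + n%:R * x) <= 1.
Proof.
move=> /andP[x0 x1]; elim: n => [|n IH]; first by rewrite mul0r addr0 mulr1.
apply: le_trans IH; rewrite exprSr -mulrA ler_wpM2l ?exprn_ge0 ?subr_ge0//.
have n0 : 0 <= n%:R * x * x by rewrite !mulr_ge0.
by rewrite -[n.+1%:R]natr1; nra.
Qed.

(* Chosen so that 2^-(slack m) <= 1 / ((m + 1) (m + 2)), a telescoping series,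
   while slack m = o(m). *)
Definition slack m := (2 * up_log 2 m.+2)%N.

Lemma slack_homo : {homo slack : m n / (m <= n)%N}.
Proof. by move=> m n mn; rewrite leq_mul2l/= leq_up_log. Qed.

Lemma leq_exp_slack m : (m.+1 * m.+2 <= 2 ^ slack m)%N.
Proof.
rewrite /slack mul2n -addnn expnD leq_mul ?up_logP//.
exact: leq_trans (up_logP _ _).
Qed.

Lemma slack_sublinear q :
  exists M, forall m, (M <= m)%N -> (q * (slack m.+1).+1 <= m)%N.
Proof.
(* With [v] as below, the claim reads q (2 v + 3) <= m, and [M] is the left side at v = 10 q + 5.
   For larger [v], [v2] and 2^v < m + 3 make m outgrow it. *)
exists (q * (20 * q + 13))%N => m Mm; rewrite /slack.
have u0 : (0 < up_log 2 m.+3)%N by rewrite up_log_gt0.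
have := @up_log_gtn 2 m.+3 isT isT; rewrite -(prednK u0) /=.
move: (up_log 2 m.+3).-1 => v vm.
have v2 : (v * v <= v + 2 * 2 ^ v)%N.
  elim: v {vm} => // v IH; have := ltn_expl v (isT : (1 < 2)%N); rewrite expnS; nia.
rewrite leqNgt; apply/negP => mq.
have [vq|vq] := leqP v (10 * q + 5); nia.
Qed.

(** * Borel-Cantelli along the powers of 2 *)

Section borel_cantelli.
Context {R : realType}.

(** Bernoulli with x = 2^-(m - slack m) and n = 2^m, where n x = 2^(slack m). *)
Lemma low_decay m : (1 - 2 ^- (m - slack m)) ^+ (2 ^ m) <= 2 ^- slack m :> R.
Proof.
have p n : 0 < (2 : R) ^+ n by rewrite exprn_gt0.
have [sm|ms] := leqP (slack m) m; last first.
  (* The truncated subtraction gives the bound 0, since every digit is > 0. *)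
  have -> : (m - slack m = 0)%N by apply/eqP; rewrite subn_eq0 ltnW.
  by rewrite expr0 invr1 subrr expr0n expn_eq0/= invr_ge0 ltW.
set k := (m - slack m)%N.
have k01 : 0 <= (2 : R) ^- k <= 1.
  by rewrite invr_ge0 ltW//= invf_le1// exprn_ege1// ler1n.
have := expr1B_bernoulli R (2 ^- k) (2 ^ m) k01.
have -> : (2 ^ m)%:R * 2 ^- k = 2 ^+ slack m :> R.
  by rewrite natrX -{1}(subnKC sm) exprD mulfK ?gt_eqF.
move=> h; rewrite -[leRHS]mul1r ler_pdivlMr//; apply: le_trans h.
rewrite ler_wpM2l ?lerDr// exprn_ge0// subr_ge0.
by case/andP: k01.
Qed.

Definition atypical m : set R :=
  low (m - slack m) (2 ^ m) `|` high (m + slack m) (2 ^ m).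

Lemma atypical_le m : measurable (atypical m) /\
  (lebesgue_measure (atypical m) <=
    (2 * (m.+1%:R^-1 - m.+2%:R^-1) : R)%:E)%E.
Proof.
apply: affine_bounded_le.
apply: affine_boundedW; last first.
  by apply: affine_boundedU; [exact: affine_bounded_low|exact: affine_bounded_high].
have sm : (2 : R) ^- slack m <= m.+1%:R^-1 - m.+2%:R^-1.
  have -> : m.+1%:R^-1 - m.+2%:R^-1 = (m.+1 * m.+2)%:R^-1 :> R.
    have y0 : 0 < m.+1%:R :> R by rewrite ltr0n.
    rewrite natrM -[m.+2%:R]natr1; move: (m.+1%:R) y0 => y y0.
    by field; rewrite !gt_eqF// addr_gt0.
  by rewrite lef_pV2 ?posrE ?exprn_gt0// -natrX ler_nat leq_exp_slack.
have -> : (2 ^ m)%:R * 2 ^- (m + slack m) = 2 ^- slack m :> R.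
  by rewrite natrX exprD invfM mulVKf// expf_neq0.
by rewrite mulr_natl mulr2n lerD// (le_trans (low_decay m)).
Qed.

Lemma ae_typical : {ae @lebesgue_measure R, forall x : R,
  \forall m \near \oo, ~ atypical m x}.
Proof.
exists (lim_sup_set atypical); split.
- apply: bigcap_measurable => // n _; apply: bigcup_measurable => k _.
  exact: (atypical_le k).1.
- apply: lim_sup_set_cvg0 => [k|]; first exact: (atypical_le k).1.
  apply: (@le_lt_trans _ _ (2 : R)%:E); last exact: ltry.
  apply: lime_le; first exact: is_cvg_nneseries.
  apply: nearW => n.
  apply: (@le_trans _ _ (\sum_(0 <= m < n) (2 * (m.+1%:R^-1 - m.+2%:R^-1) : R)%:E)%E).
    by apply: lee_sum => m _; exact: (atypical_le m).2.
  rewrite sumEFin lee_fin -mulr_sumr.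
  (* The partial sums are 2 (1 - 1/(n + 1)), hence at most 2. *)
  rewrite (telescope_sumr_eq (fun m => - m.+1%:R^-1 : R))//; last first.
    by move=> k _; rewrite opprK addrC.
  rewrite opprK invr1 mulrDr mulr1 gerDr.
  by rewrite mulr_ge0_le0// oppr_le0 invr_ge0.
- move=> x /= nx n _; apply: contrapT => h; apply: nx.
  by exists n => // k /= nk; apply: contra_not h => ?; exists k.
Qed.

End borel_cantelli.

(** * From powers of 2 to all n *)

Lemma max_digit_homo (R : realType) (x : R) :
  {homo (fun n => max_digit n x) : m n / (m <= n)%N}.
Proof.
move=> m n mn /=; rewrite /max_digit [leqRHS](@big_cat_nat _ _ _ m.+1)//=.
exact: leq_maxl.
Qed.

Lemma log2_exp (R : realType) m : log2 (2 ^+ m) = m%:R :> R.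
Proof.
have l2 : 0 < ln (2 : R) by rewrite ln_gt0// ltr1n.
by rewrite /log2 lnXn// -[X in X / _]mulr_natl mulfK// gt_eqF.
Qed.

Lemma le_log2 (R : realType) : {in Num.pos &, {mono @log2 R : x y / x <= y}}.
Proof.
move=> x y x0 y0; have l2 : 0 < ln (2 : R) by rewrite ln_gt0// ltr1n.
by rewrite /log2 ler_pM2r ?invr_gt0// ler_ln.
Qed.

Theorem theorem1p3 (R : realType) :
  {ae @lebesgue_measure R, forall x : R, x \in `]0, 1] ->
    (fun n : nat => (max_digit n x)%:R / log2 (n%:R : R)) @ \oo --> (1 : R)}.
Proof.
apply: (negligibleS _ (@ae_typical R)) => x.
apply: contra_not => -[N _ typ] x01.
(* Stated with sums to avoid truncated subtraction. *)
have {typ} typ m : (N <= m)%N ->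
    (m <= max_digit (2 ^ m) x + slack m)%N /\
    (max_digit (2 ^ m) x <= m + slack m)%N.
  move=> /typ nbad; split; rewrite leqNgt; apply/negP => h; apply: nbad.
    by left; split=> //; lia.
  by right; split.
apply/cvgrPdist_lt => e e0.
(* This makes e q > 1, so that q (s + 1) <= m will give s + 1 < e m. *)
set q := (Num.truncn e^-1).+1.
have [M Mq] := slack_sublinear q.
pose B := maxn 1 (maxn N M).
exists (2 ^ B)%N => // n /= Bn.
have n0 : (0 < n)%N by apply: leq_trans Bn; rewrite expn_gt0.
set m := trunc_log 2 n.
have Bm : (B <= m)%N by rewrite trunc_log_max.
have /andP[mn nm] : (2 ^ m <= n < 2 ^ m.+1)%N by exact: trunc_log_bounds.
have [m0 Nm Mm] : [/\ 0 < m, N <= m & M <= m]%N by split; lia.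
(* The index 2^m bounds the maximum from below, 2^(m+1) from above; the slack at m + 1 serves for
   both. *)
have [lo _] := typ _ Nm.
have [_ up] := typ _ (leqW Nm).
have Lm := max_digit_homo R x _ _ mn; have Lm1 := max_digit_homo R x _ _ (ltnW nm).
have smS := slack_homo _ _ (leqnSn m).
have := Mq _ Mm.
set L := max_digit n x; set s := slack m.+1 => qs.
have mlog : m%:R <= log2 (n%:R : R).
  by rewrite -(log2_exp R m) le_log2 ?posrE ?exprn_gt0 ?ltr0n// -natrX ler_nat.
have logm : log2 (n%:R : R) <= m%:R + 1.
  by rewrite natr1 -(log2_exp R m.+1) le_log2 ?posrE ?exprn_gt0 ?ltr0n// -natrX ler_nat ltnW.
have hlo : m%:R <= L%:R + s%:R :> R by rewrite -natrD ler_nat; lia.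
have hup : L%:R <= m%:R + 1 + s%:R :> R by rewrite natr1 -natrD ler_nat; lia.
have mp : 0 < m%:R :> R by rewrite ltr0n.
have lp : 0 < log2 (n%:R : R) by exact: lt_le_trans mlog.
have -> : 1 - L%:R / log2 n%:R = (log2 n%:R - L%:R) / log2 n%:R :> R.
  by rewrite mulrBl mulfV// gt_eqF.
rewrite normrM normfV (gtr0_norm lp) ltr_pdivrMr//.
(* [L] lies in [m - s, m + 1 + s] and log2 n in [m, m + 1]. *)
apply: (@le_lt_trans _ _ (s%:R + 1)); first by rewrite ler_norml; lra.
apply: (@lt_le_trans _ _ (e * m%:R)); last by rewrite ler_pM2l.
have qs' : q%:R * (s%:R + 1) <= m%:R :> R by rewrite natr1 -natrM ler_nat.
have eq1 : 1 < e * q%:R.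
  by rewrite mulrC -ltr_pdivrMr// mul1r truncnS_gt.
apply: (@lt_le_trans _ _ (e * (q%:R * (s%:R + 1)))); last by rewrite ler_pM2l.
by rewrite mulrA ltr_pMl// natr1 ltr0n.
Qed.
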